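(* (i) There exists a collection of languages that is generatable in the limit with feedback but is not generatable in the limit (without feedback). (ii) For every collection $\mathcal C$ and every $i\in\mathbb N$, if $\mathcal C$ is generatable in the limit with $i$ queries, then $\mathcal C$ is generatable in the limit without queries.
   Context: A language is an infinite subset of a countably infinite universe $U$; a collection is a set of languages. An enumeration of $K$ is an infinite sequence $x_0,x_1,\dots$ of pairwise distinct elements of $K$ containing every element of $K$; $S_t=\{x_0,\dots,x_t\}$. Generation in the limit (without feedback): a function $G$ from finite sequences in $U$ to $U$ such that for every $K\in\mathcal C$ and every enumeration of $K$ there is $t^\star$ with $G(x_0,\dots,x_t)\in K\setminus S_t$ for all $t\ge t^\star$. Generation with feedback: at each time $t$ the adversary reveals $x_t$, the algorithm then asks a membership query $y_t=G(x_0,a_0,\dots,a_{t-1},x_t)\in U$ and receives $a_t\in\{\mathrm{Yes},\mathrm{No}\}$ indicating whether $y_t\in K$, and then outputs $z_t=G(x_0,a_0,\dots,x_t,a_t)$; $G$ generates in the limit with feedback for $\mathcal C$ if for every $K\in\mathcal C$ and every enumeration of $K$ there is $t^\star$ with $z_t\in K\setminus S_t$ for all $t\ge t^\star$. A generator with $i$ queries is the same except that a query may be the symbol $\bot$ (no query, answered by $\bot$), and for every interaction sequence at most $i$ times $t$ have $y_t\ne\bot$; generation in the limit with $i$ queries is defined analogously. *)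

(* Defs.v *)
From mathcomp Require Import all_boot all_classical.

Set Implicit Arguments.
Unset Strict Implicit.
Unset Printing Implicit Defensive.

Local Open Scope classical_set_scope.
Local Open Scope card_scope.

Definition countably_infinite (U : Type) : Prop := [set: U] #= [set: nat].

Section Generation.
Variable U : Type.

Definition language (K : set U) : Prop := infinite_set K.

Definition collection (C : set (set U)) : Prop :=
  forall K, C K -> language K.

Definition enumeration (K : set U) (x : nat -> U) : Prop :=
  injective x /\ range x = K.

Definition seen (x : nat -> U) (t : nat) : set U := x @` [set s | s <= t].

Definition valid_from (K : set U) (x z : nat -> U) (t0 : nat) : Prop :=
  forall t, t0 <= t -> (K `\` seen x t) (z t).

Definition generates (G : seq U -> U) (C : set (set U)) : Prop :=
  forall K x, C K -> enumeration K x ->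
    exists t0, valid_from K x (fun t => G (mkseq x t.+1)) t0.

Definition generatable (C : set (set U)) : Prop := exists G, generates G C.

(* A generator with feedback is a single function of the sequences
   x_0, a_0, ..., x_t (value: the query y_t) and
   x_0, a_0, ..., x_t, a_t (value: the output z_t).  Its restrictions to these
   two disjoint sets of sequences are the two fields below; the complete rounds
   (x_0, a_0), (x_1, a_1), ... are stored as pairs, with true for Yes. *)
Record fb_generator := FbGenerator {
  fb_ask : seq (U * bool) -> U -> U;
  fb_out : seq (U * bool) -> U
}.

(* The rounds 0, ..., t - 1. *)
Fixpoint fb_rounds (G : fb_generator) (K : set U) (x : nat -> U) (t : nat) :
    seq (U * bool) :=
  if t is s.+1 then
    let h := fb_rounds G K x s in rcons h (x s, fb_ask G h (x s) \in K)
  else [::].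

Definition fb_output (G : fb_generator) (K : set U) (x : nat -> U) (t : nat) :
    U :=
  fb_out G (fb_rounds G K x t.+1).

Definition generates_with_feedback (G : fb_generator) (C : set (set U)) :
    Prop :=
  forall K x, C K -> enumeration K x ->
    exists t0, valid_from K x (fb_output G K x) t0.

Definition generatable_with_feedback (C : set (set U)) : Prop :=
  exists G, generates_with_feedback G C.

(* As above, None standing for the symbol "bottom", both as a query and as an
   answer. *)
Record q_generator := QGenerator {
  q_ask : seq (U * option bool) -> U -> option U;
  q_out : seq (U * option bool) -> U
}.

Definition q_answer (K : set U) (y : option U) : option bool :=
  if y is Some u then Some (u \in K) else None.

Fixpoint q_rounds (G : q_generator) (K : set U) (x : nat -> U) (t : nat) :
    seq (U * option bool) :=
  if t is s.+1 then
    let h := q_rounds G K x s in rcons h (x s, q_answer K (q_ask G h (x s)))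
  else [::].

Definition q_query (G : q_generator) (K : set U) (x : nat -> U) (t : nat) :
    option U :=
  q_ask G (q_rounds G K x t) (x t).

Definition q_output (G : q_generator) (K : set U) (x : nat -> U) (t : nat) :
    U :=
  q_out G (q_rounds G K x t.+1).

(* A property of G alone: the interaction sequences are those of G with any
   language K and any enumeration of K, without reference to a collection. *)
Definition at_most_queries (i : nat) (G : q_generator) : Prop :=
  forall K x, language K -> enumeration K x ->
    [set t | q_query G K x t <> None] #<= `I_i.

Definition generates_with_queries (G : q_generator) (C : set (set U)) : Prop :=
  forall K x, C K -> enumeration K x ->
    exists t0, valid_from K x (q_output G K x) t0.

Definition generatable_with_queries (i : nat) (C : set (set U)) : Prop :=
  exists G, at_most_queries i G /\ generates_with_queries G C.

End Generation.

(* Main.v *)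
(** (i) Identify the universe with the natural numbers and take the languages
    that contain all even numbers or all large odd numbers.  With feedback,
    query the even numbers one after another: output large even numbers until
    a No arrives, and large odd numbers afterwards.  Without feedback, an
    adversary lists large odd numbers until the generator outputs an unseen
    odd number (it must, since what is shown is consistent with a language of
    the second kind), bans this number for ever, lists one more even number,
    and repeats.  The limit contains all even numbers and misses all the banned
    numbers, so the generator errs infinitely often.

    (ii) At time [T], rerun the generator from scratch on [x_0, ..., x_T],
    answering each query as if the language were the finite set of elements
    seen so far.  Only finitely many queries are asked in the true interaction,
    and each queried element of [K] is listed eventually, so from some time on
    the simulated interaction is the true one. *)

Require Import Defs.
From mathcomp Require Import all_boot all_classical.
From mathcomp Require Import zify.

Set Implicit Arguments.
Unset Strict Implicit.
Unset Printing Implicit Defensive.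

Local Open Scope classical_set_scope.
Local Open Scope card_scope.

(** * Finitely many queries *)

Section Queries.
Variables (U : Type) (G : q_generator U).

Lemma q_rounds_eq (K L : set U) (x y : nat -> U) (n : nat) :
  (forall t, t < n -> x t = y t) ->
  (forall t u, t < n -> q_query G K x t = Some u -> (u \in K) = (u \in L)) ->
  forall t, t <= n -> q_rounds G K x t = q_rounds G L y t.
Proof.
move=> exy eKL; elim=> [//|t IHt] ltn /=.
have query_t u := eKL t u ltn.
rewrite -(IHt (ltnW ltn)) -(exy t ltn); move: query_t; rewrite /q_query.
by case: (q_ask G _ _) => [u /(_ _ erefl) /= ->|].
Qed.

(** Each queried element of [K] is listed at some time; a maximum over the finitely many querying
    times bounds all of these. *)
Lemma finite_queries_seen (K : set U) (x : nat -> U) :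
  enumeration K x -> finite_set [set t | q_query G K x t <> None] ->
  exists T, forall t u, q_query G K x t = Some u -> K u -> seen x T u.
Proof.
move=> [_ rK] /finite_seqP[r query_r].
have /choice[s listed_s] t : exists s,
    forall u, q_query G K x t = Some u -> K u -> x s = u.
  case: (q_query G K x t) => [v|]; last by exists 0.
  have [|nKv] := pselect (K v); last by exists 0 => u [<-].
  by rewrite -{1}rK => -[s _ xs]; exists s => u [<-].
exists (\max_(t <- r) s t) => t u qt Ku.
exists (s t); last exact: listed_s qt Ku.
have tr : t \in r.
  have : [set t | q_query G K x t <> None] t by rewrite /= qt.
  by rewrite query_r.
exact: leq_bigmax_seq.
Qed.

Lemma finite_queries_generatable (C : set (set U)) (u0 : U) :
  (forall K x, C K -> enumeration K x ->
    finite_set [set t | q_query G K x t <> None]) ->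
  generates_with_queries G C -> generatable C.
Proof.
move=> finG genG.
(* The simulated language is the set of entries of [s]; on a nonempty [s] the default [u0] is never
   read. *)
exists (fun s => q_out G (q_rounds G (seen (nth u0 s) (size s).-1)
                                     (nth u0 s) (size s))) => K x CK enum_x.
have [T seenT] := finite_queries_seen enum_x (finG K x CK enum_x).
have [t0 valid_t0] := genG K x CK enum_x.
exists (maxn T t0) => t; rewrite geq_max => /andP[leTt let0t].
have := valid_t0 t let0t; rewrite /q_output.
rewrite (@q_rounds_eq _ (seen (nth u0 (mkseq x t.+1)) t) _
  (nth u0 (mkseq x t.+1)) t.+1) ?size_mkseq //.
  by move=> s lt_s; rewrite nth_mkseq.
(* From time [T] on, every queried element of [K] has been listed, and everything listed lies in
   [K], so the simulated answers are the true ones. *)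
move=> s u lt_s qs; apply/idP/idP; rewrite !inE.
  move=> /(seenT _ _ qs)[k /= leT xk]; exists k; first exact: leq_trans leTt.
  by rewrite nth_mkseq // ltnS (leq_trans leT).
case=> k /= lekt <-; rewrite nth_mkseq //.
by case: enum_x => _ <-; exists k.
Qed.

End Queries.

(** * Feedback at every step *)

Section Feedback.
Variables (U : Type) (f : U -> nat) (g : nat -> U).
Hypothesis gK : cancel g f.

Definition evens_or_large_odds : set (set U) :=
  [set K | (forall n, K (g n.*2)) \/
           exists N, forall n, N <= n -> K (g n.*2.+1)].

Lemma evens_or_large_odds_infinite : collection evens_or_large_odds.
Proof.
move=> K CK; have [h inj_h Kh] : exists2 h : nat -> nat,
    injective h & forall n, K (g (h n)).
  case: CK => [Ke|[N Ko]]; first by exists double => // m n; lia.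
  exists (fun n => (N + n).*2.+1) => [m n|n]; first by lia.
  by apply: Ko; exact: leq_addr.
move=> finK; apply: infinite_nat.
rewrite (_ : [set: nat] = (g \o h) @^-1` K); last first.
  by apply/seteqP; split=> // n _; exact: Kh.
by apply: finite_preimage finK => m n _ _ /= /(can_inj gK)/inj_h.
Qed.

(** The maximum keeps outputs clear of everything listed; the length makes the bound strict and
    drives the index past any threshold for the odd numbers. *)
Definition fresh_index (h : seq (U * bool)) : nat :=
  size h + \max_(p <- h) (f p.1).

Definition evens_then_odds : fb_generator U :=
  FbGenerator (fun h _ => g (size h).*2)
    (fun h => if all snd h then g (fresh_index h).*2
              else g (fresh_index h).*2.+1).

Lemma size_fb_rounds (G : fb_generator U) (K : set U) (x : nat -> U) (t : nat) :
  size (fb_rounds G K x t) = t.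
Proof. by elim: t => //= t IHt; rewrite size_rcons IHt. Qed.

Lemma fresh_index_gt (G : fb_generator U) (K : set U) (x : nat -> U)
    (s t : nat) :
  s < t -> f (x s) < fresh_index (fb_rounds G K x t).
Proof.
move=> lt_st; rewrite /fresh_index size_fb_rounds.
suff : f (x s) <= \max_(p <- fb_rounds G K x t) f p.1 by lia.
elim: t lt_st => //= t IHt lt_st; rewrite big_rcons /=.
by move: lt_st; rewrite ltnS leq_eqVlt => /predU1P[->|/IHt]; lia.
Qed.

Lemma all_evens_answers (K : set U) (x : nat -> U) (t : nat) :
  all snd (fb_rounds evens_then_odds K x t) <-> forall s, s < t -> K (g s.*2).
Proof.
elim: t => [|t IHt] //=; rewrite all_rcons /= size_fb_rounds; split.
  move=> /andP[]; rewrite inE => Kt /IHt Ks s; rewrite ltnS leq_eqVlt.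
  by move=> /predU1P[->|/Ks].
move=> Ks; apply/andP; split; first by rewrite inE; exact: Ks.
by apply/IHt => s lt_st; apply: Ks; exact: ltnW.
Qed.

Lemma evens_then_odds_generates :
  generates_with_feedback evens_then_odds evens_or_large_odds.
Proof.
move=> K x CK enum_x.
have fresh t n : fresh_index (fb_rounds evens_then_odds K x t.+1) <= n ->
    ~ seen x t (g n).
  move=> le_n [s /= le_st xs].
  have := @fresh_index_gt evens_then_odds K x s t.+1 le_st.
  by rewrite xs gK; lia.
have outE t : fb_output evens_then_odds K x t =
    let h := fb_rounds evens_then_odds K x t.+1 in
    if all snd h then g (fresh_index h).*2 else g (fresh_index h).*2.+1.
  by [].
have [Ke|nKe] := pselect (forall n, K (g n.*2)).
  exists 0 => t _; rewrite outE; cbv zeta.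
  have -> : all snd (fb_rounds evens_then_odds K x t.+1).
    by apply/all_evens_answers => s _; exact: Ke.
  by split; [exact: Ke | apply: fresh; lia].
case: CK => // -[N Ko].
have [n nKn] : exists n, ~ K (g n.*2) by exact/existsNP.
(* Round [n] queries [g n.*2] and receives No, which stays in the history; [N] makes the odd output
   belong to [K]. *)
exists (maxn N n) => t; rewrite geq_max => /andP[leNt lent].
rewrite outE; cbv zeta; rewrite ifF; last first.
  by apply/negP => /all_evens_answers/(_ n lent).
split; last by apply: fresh; lia.
by apply: Ko; rewrite /fresh_index size_fb_rounds; lia.
Qed.

End Feedback.

(** The adversary plays on [nat], so a generator on [U] is conjugated by the bijection. *)
Lemma generatable_transfer (U : Type) (f : U -> nat) (g : nat -> U) :
  cancel g f -> cancel f g ->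
  generatable (evens_or_large_odds g) -> generatable (evens_or_large_odds id).
Proof.
move=> gK fK [G genG]; exists (fun s => f (G (map g s))) => K x CK [inj_x rK].
have [||t0 valid_t0] := genG (f @^-1` K) (g \o x).
- by case: CK => [Ke|[N Ko]]; [left|right; exists N] => n *;
    rewrite /preimage /= gK; [exact: Ke|exact: Ko].
- split; first by apply: inj_comp => //; exact: can_inj gK.
  apply/seteqP; split=> u /=.
    by move=> [n _ <-]; rewrite /preimage /= gK -rK; exists n.
  by rewrite /preimage /= -{1}rK => -[n _ xn]; exists n => //=; rewrite xn fK.
exists t0 => t /valid_t0 []; rewrite /mkseq map_comp /= => KG nseen.
split=> // -[s le_st xs]; apply: nseen; exists s => //=.
by rewrite xs fK.
Qed.

(** * The adversary *)

Section Adversary.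
Variable G : seq nat -> nat.
Hypothesis genG : generates G (evens_or_large_odds id).

(* [s] has been listed, [P] is banned. *)
Definition admissible (s P : seq nat) : Prop :=
  [/\ uniq s, {in P, forall p, odd p} & {in P, forall p, p \notin s}].

(** Continue [s] with consecutive odd numbers above all of [s] and [P]. The range of this sequence
    is a language of the second kind, so [G] must eventually output one of its later terms, which
    can then be banned. *)
Lemma force_fresh_odd (s P : seq nat) : admissible s P ->
  exists2 s', admissible (s ++ s') (G (s ++ s') :: P) & 0 < size s'.
Proof.
move=> [uniq_s odd_P disjP].
pose M := \max_(n <- s ++ P) n.
have leM n : n \in s ++ P -> n <= M by move=> ns; exact: leq_bigmax_seq.
pose y n := (M + n).*2.+1.
pose x n := if n < size s then nth 0 s n else y (n - size s).
have nth_le n : n < size s -> nth 0 s n <= M.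
  by move=> lt_n; apply: leM; rewrite mem_cat mem_nth.
have inj_x : injective x.
  move=> m n; rewrite /x /y.
  case: ltnP => [lt_m|le_m]; case: ltnP => [lt_n|le_n].
  - by move=> /eqP; rewrite nth_uniq // => /eqP.
  - by have := nth_le _ lt_m; lia.
  - by have := nth_le _ lt_n; lia.
  - by lia.
have mkseq_x n : mkseq x (size s + n) = s ++ mkseq y n.
  apply: (@eq_from_nth _ 0); rewrite ?size_cat ?size_mkseq // => k lt_k.
  rewrite nth_mkseq // nth_cat /x; case: ltnP => // le_k.
  by rewrite nth_mkseq //; lia.
have [t0 valid_t0] : exists t0, valid_from (range x) x
    (fun t => G (mkseq x t.+1)) t0.
  apply: genG => //; right; exists M => n le_n.
  exists (size s + (n - M)) => //; rewrite /x ltnNge leq_addr /= /y.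
  by congr (_.*2.+1); lia.
exists (mkseq y t0.+1); last by rewrite size_mkseq.
(* Waiting [size s] more steps ensures that all of [s] has been shown, so an unseen output is one of
   the new odd numbers. *)
have := valid_t0 (size s + t0) (leq_addl _ _).
rewrite -addnS mkseq_x; set q := G _ => -[[k _ xk]] nseen.
have lt_k : size s + t0 < k.
  by rewrite ltnNge; apply/negP => le_k; apply: nseen; exists k.
have q_def : q = y (k - size s) by rewrite -xk /x ltnNge ifF //; lia.
have gtM n : n \in s ++ P -> n < y 0 by move=> /leM; rewrite /y; lia.
have fresh p : p \in s ++ P -> forall n, p != y n.
  by move=> /gtM lt_p n; rewrite /y in lt_p *; lia.
have inj_y : injective y by move=> m n; rewrite /y; lia.
split.
- rewrite cat_uniq uniq_s mkseq_uniq // andbT.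
  apply/hasPn => _ /mapP[n _ ->]; apply/negP => ys.
  by have := fresh (y n); rewrite mem_cat ys => /(_ isT n); rewrite eqxx.
- move=> p; rewrite inE => /predU1P[->|/odd_P//].
  by rewrite q_def /y /= odd_double.
- move=> p; rewrite inE mem_cat negb_or => /predU1P[->|pP].
    apply/andP; split; rewrite q_def.
      apply/negP => ys.
      have := fresh (y (k - size s)).
      by rewrite mem_cat ys => /(_ isT (k - size s)); rewrite eqxx.
    by apply/negP => /mapP[n]; rewrite mem_iota => lt_n /inj_y; lia.
  rewrite disjP //=; apply/negP => /mapP[n _ pn].
  by have := fresh p; rewrite mem_cat pP orbT => /(_ isT n); rewrite pn eqxx.
Qed.

(** Listing an even number is always safe, since banned numbers are odd; it is skipped if already
    listed. *)
Lemma adversary_step (n : nat) (s P : seq nat) : admissible s P ->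
  exists s' : seq nat, exists2 s'' : seq nat,
    admissible (s ++ s' ++ s'') (G (s ++ s') :: P) &
    0 < size s' /\ n.*2 \in s ++ s' ++ s''.
Proof.
move=> /force_fresh_odd[s' [uniq_s odd_P disjP] size_s']; exists s'.
case: (boolP (n.*2 \in s ++ s')) => [ns|ns].
  by exists [::]; rewrite cats0.
exists [:: n.*2]; last by rewrite !mem_cat inE eqxx !orbT.
rewrite catA cats1; split=> //; first by rewrite rcons_uniq ns.
move=> p pP; rewrite mem_rcons inE negb_or disjP // andbT.
by apply/eqP => pn; have := odd_P p pP; rewrite pn odd_double.
Qed.

Lemma adversary_contradiction : False.
Proof.
(* Admissibility sits under the existential so that [F] is total, with a dummy value on inadmissible
   states. *)
have /choice[F stepF] (nsP : nat * (seq nat * seq nat)) :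
    exists F : seq nat * seq nat, let: (n, (s, P)) := nsP in admissible s P ->
    [/\ admissible (s ++ F.1 ++ F.2) (G (s ++ F.1) :: P), 0 < size F.1
      & n.*2 \in s ++ F.1 ++ F.2].
  case: nsP => n [s P].
  have [/(adversary_step n)|nadm] := pselect (admissible s P).
    by move=> [s' [s'' adm [size_s' ns]]]; exists (s', s'').
  by exists ([::], [::]).
pose state := fix state n := if n is m.+1 then
    let: (s, P) := state m in let: (s', s'') := F (m, (s, P)) in
    (s ++ s' ++ s'', G (s ++ s') :: P) else ([::], [::]) : seq nat * seq nat.
have adm n : admissible (state n).1 (state n).2.
  elim: n => [//|n] /=; case: (state n) => s P /= /(stepF (n, (s, P))).
  by case: (F _) => s' s'' [].
pose lists n := (state n).1; pose bans n := (state n).2.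
have step n : exists s' s'', [/\ lists n.+1 = lists n ++ s' ++ s'',
    bans n.+1 = G (lists n ++ s') :: bans n, 0 < size s'
    & n.*2 \in lists n.+1].
  have := adm n; rewrite /lists /bans /=; case: (state n) => s P /=.
  by move=> /(stepF (n, (s, P))); case: (F _) => s' s'' [? ? ?]; exists s', s''.
have mono m n : m <= n ->
    prefix (lists m) (lists n) /\ {subset bans m <= bans n}.
  elim: n => [|n IHn]; first by rewrite leqn0 => /eqP->; split.
  rewrite leq_eqVlt => /predU1P[->|/IHn[pre sub]]; first by split=> //; exact: prefix_refl.
  have [s' [s'' [-> -> _ _]]] := step n; split.
    by apply: prefix_trans pre _; exact: prefix_prefix.
  by move=> p /sub; rewrite inE => ->; rewrite orbT.
have size_lists n : n <= size (lists n).
  elim: n => // n IHn; have [s' [s'' [-> _ lt0 _]]] := step n.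
  by rewrite !size_cat; lia.
(* The lists are nested prefixes and [lists n.+1] has more than [n] entries, so this is their
   limit. *)
pose x n := nth 0 (lists n.+1) n.
have nth_lists n k : k < size (lists n) -> nth 0 (lists n) k = x k.
  move=> lt_k; rewrite /x; case: (leqP n k.+1) => [le_n|/ltnW le_k].
    have [/prefixP[s ->] _] := mono _ _ le_n.
    by rewrite nth_cat lt_k.
  have [/prefixP[s ->] _] := mono _ _ le_k.
  by rewrite nth_cat size_lists.
have x_lists n k : k < n -> x k \in lists n.
  move=> lt_k; have lt_k' := leq_trans lt_k (size_lists n).
  by rewrite -(nth_lists n) // mem_nth.
have lists_x n p : p \in lists n -> range x p.
  by move=> /(nthP 0)[k lt_k <-]; rewrite nth_lists //; exists k.
have inj_x : injective x.
  move=> j k; pose n := (maxn j k).+1.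
  have [lt_j lt_k] : j < size (lists n) /\ k < size (lists n).
    by split; apply: leq_trans (size_lists n); rewrite /n; lia.
  rewrite -(nth_lists n j) // -(nth_lists n k) // => /eqP.
  by have [uniq_s _ _] := adm n; rewrite nth_uniq // => /eqP.
(* The limit lists every even number, hence its range is a language of the first kind. *)
have [|//|t0 valid_t0] := genG (K := range x) (x := x).
  left=> n; have [s' [s'' [_ _ _]]] := step n; exact: lists_x.
have [s' [s'' [def_s def_P lt0 _]]] := step t0.
(* At this time [G] sees exactly [lists t0 ++ s'], and its output there is the number banned at
   stage [t0]. *)
pose t := (size (lists t0 ++ s')).-1.
have size_t : size (lists t0 ++ s') = t.+1 by rewrite /t size_cat; lia.
have [] := valid_t0 t; first by rewrite /t size_cat; have := size_lists t0; lia.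
have -> : mkseq x t.+1 = lists t0 ++ s'.
  apply: (@eq_from_nth _ 0); rewrite ?size_mkseq // => k lt_k.
  rewrite nth_mkseq // -(nth_lists t0.+1); last first.
    by rewrite def_s catA size_cat size_t; lia.
  by rewrite def_s catA nth_cat size_t lt_k.
(* By stage [n] the output [x k] would be both listed and banned. *)
move=> [k _ xk] _; pose n := maxn k.+1 t0.+1.
have [_ sub] := mono _ _ (leq_maxr k.+1 t0.+1).
have banned_xk : x k \in bans n by apply: sub; rewrite def_P xk mem_head.
have [_ _ /(_ _ banned_xk)] := adm n.
by rewrite -/(lists n) x_lists // leq_maxl.
Qed.

End Adversary.

Lemma evens_or_large_odds_not_generatable :
  ~ generatable (evens_or_large_odds (@id nat)).
Proof. by move=> [G]; exact: adversary_contradiction. Qed.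

Theorem theorem1p6 (U : Type) (hU : countably_infinite U) :
  (exists C : set (set U),
     [/\ collection C, generatable_with_feedback C & ~ generatable C]) /\
  (forall (C : set (set U)) (i : nat),
     collection C -> generatable_with_queries i C -> generatable C).
Proof.
have [f [inj_f surj_f]] : exists f : U -> nat, injective f /\
    forall n, exists u, f u = n.
  have /card_set_bijP[f [_ inj_f surj_f]] := hU.
  exists f; split=> [u v|n]; first by apply: inj_f; rewrite inE.
  by have [u _ <-] := surj_f n I; exists u.
have [g gK] := choice surj_f.
have fK : cancel f g by move=> u; apply: inj_f.
split.
  exists (evens_or_large_odds g); split.
  - exact: evens_or_large_odds_infinite gK.
  - by exists (evens_then_odds f g); exact: evens_then_odds_generates gK.
  - move=> /(generatable_transfer gK fK).
    exact: evens_or_large_odds_not_generatable.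
move=> C i colC [G [fewG genG]].
apply: (finite_queries_generatable (g 0) _ genG) => K x CK enum_x.
by apply/finite_set_leP; exists i; apply: fewG enum_x; exact: colC.
Qed.
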